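(* Let $\mathcal{L}\subseteq\mathbb{C}^n$ be a linear subspace and $I\subseteq[n]$, and suppose the matroid $M=M(\mathcal{L})$ has no loops in $I$. For $S\subseteq[n]$ let $T=S\cup([n]\setminus I)$. If $T$ is a flat of $M$, then $$\mathrm{inv}_I(\mathcal{L})\cap\mathbb{C}^S=\mathrm{inv}_{S\cap I}\big(\pi_T(\mathcal{L})\cap\mathbb{C}^S\big),$$ where $\pi_T:\mathbb{C}^n\to\mathbb{C}^T$ is the coordinate projection. Moreover, there exists $\mathbf{p}\in\mathrm{inv}_I(\mathcal{L})$ with $\mathrm{supp}(\mathbf{p})=S$ if and only if $T$ is a flat of $M$ and $T\setminus S$ is a flat of the restriction $M|_T$.
   Context: $\mathrm{inv}_I$ replaces $x_i$ by $1/x_i$ for $i\in I$ and fixes other coordinates; $\mathrm{inv}_I(\mathcal{L})$ is the Zariski closure of the image of $\mathcal{L}$. $M(\mathcal{L})$ is the matroid on $[n]$ where $S$ is independent iff the coordinate forms $x_j$, $j\in S$, are linearly independent on $\mathcal{L}$; a flat is a set $F$ with $\mathrm{rank}(F\cup\{i\})>\mathrm{rank}(F)$ for all $i\notin F$; $M|_T$ is the restriction to $T$. $\mathrm{supp}(\mathbf{p})=\{i:p_i\ne0\}$ and $\mathbb{C}^S=\{\mathbf{p}\in\mathbb{C}^n:\mathrm{supp}(\mathbf{p})\subseteq S\}$; $\mathbb{C}^S$ is regarded as a coordinate subspace of $\mathbb{C}^T$ and of $\mathbb{C}^n$, so $\pi_T(\mathcal{L})\cap\mathbb{C}^S$ is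 a linear subspace of $\mathbb{C}^T$, to which $\mathrm{inv}_{S\cap I}$ is applied in $\mathbb{C}^T$, the result being viewed in $\mathbb{C}^n$ by padding with zeros. *)

(* Defs.v *)
From HB Require Import structures.
From mathcomp Require Import all_boot all_order all_algebra.

Set Implicit Arguments.
Unset Strict Implicit.
Unset Printing Implicit Defensive.

Import Order.TTheory GRing.Theory Num.Theory.

Local Open Scope ring_scope.

Record matroid (E : finType) := Matroid {
  ground : {set E};
  indep : pred {set E};
  indep_ground : forall A, indep A -> A \subset ground;
  indep_set0 : indep set0;
  indep_sub : forall A B : {set E}, A \subset B -> indep B -> indep A;
  indep_exchange : forall A B : {set E}, indep A -> indep B ->
    (#|A| < #|B|)%N -> exists2 x, x \in B :\: A & indep (x |: A) }.

Section MatroidTheory.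
Variables (E : finType) (M : matroid E).
Implicit Types (A F T : {set E}) (x : E).

Definition mrank A : nat := (\max_(B : {set E} | (B \subset A) && indep M B) #|B|)%N.

Definition loop x : bool := (x \in ground M) && ~~ indep M [set x].

Definition flat F : bool :=
  (F \subset ground M) &&
  [forall x in ground M :\: F, (mrank F < mrank (x |: F))%N].

Section Restriction.
Variable T : {set E}.

Let rindep : pred {set E} := fun A => (A \subset T) && indep M A.

Fact restr_ground A : rindep A -> A \subset ground M :&: T.
Proof. by case/andP=> AT iA; rewrite subsetI AT (indep_ground iA). Qed.

Fact restr_set0 : rindep set0.
Proof. by rewrite /rindep sub0set indep_set0. Qed.

Fact restr_sub (A B : {set E}) : A \subset B -> rindep B -> rindep A.
Proof.
move=> AB /andP[BT iB]; rewrite /rindep (subset_trans AB BT).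
exact: indep_sub iB.
Qed.

Fact restr_exchange A B : rindep A -> rindep B -> (#|A| < #|B|)%N ->
  exists2 x, x \in B :\: A & rindep (x |: A).
Proof.
move=> /andP[AT iA] /andP[BT iB] ltAB.
have [x xBA ixA] := indep_exchange iA iB ltAB; exists x => //.
rewrite /rindep ixA andbT subUset sub1set AT andbT.
by apply: (subsetP BT); case/setDP: xBA.
Qed.

Definition restriction : matroid E :=
  Matroid restr_ground restr_set0 restr_sub restr_exchange.

End Restriction.
End MatroidTheory.

Section LinearMatroid.
Variables (K : fieldType) (n : nat) (L : {vspace 'rV[K]_n}).
Implicit Types A B : {set 'I_n}.

(* x_j as an element of the dual space of L *)
Definition coord_form (j : 'I_n) : 'Hom(subvs_of L, K^o) :=
  linfun (fun u : subvs_of L => (vsval u 0 j : K^o)).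

Fact coord_formE j u : coord_form j u = vsval u 0 j.
Proof.
pose f (u : subvs_of L) : K^o := vsval u 0 j.
have lf : linear f by move=> a v w; rewrite /f linearP !mxE.
pose m := GRing.isLinear.Build _ _ _ _ f lf.
pose g : {linear subvs_of L -> K^o} := HB.pack f m.
exact: (lfunE g).
Qed.

Definition lin_indep : pred {set 'I_n} :=
  fun A => free [seq coord_form j | j <- enum A].

Fact lin_ground A : lin_indep A -> A \subset [set: 'I_n].
Proof. by rewrite subsetT. Qed.

Fact lin_set0 : lin_indep set0.
Proof. by rewrite /lin_indep enum_set0 nil_free. Qed.

Fact lin_sub A B : A \subset B -> lin_indep B -> lin_indep A.
Proof.
move=> /setIidPr <-; rewrite /lin_indep.
have /perm_free -> : perm_eq [seq coord_form j | j <- enum B]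
    ([seq coord_form j | j <- enum (B :&: A)] ++
     [seq coord_form j | j <- enum (B :\: A)]).
  rewrite -map_cat perm_map //; apply: uniq_perm.
  - exact: enum_uniq.
  - rewrite cat_uniq !enum_uniq andbT /= -all_predC; apply/allP => x /=.
    by rewrite !mem_enum !inE => /andP[/negPf -> ->].
  by move=> x; rewrite mem_cat !mem_enum !inE; case: (x \in A); case: (x \in B).
exact: catl_free.
Qed.

Fact lin_exchange A B : lin_indep A -> lin_indep B -> (#|A| < #|B|)%N ->
  exists2 x, x \in B :\: A & lin_indep (x |: A).
Proof.
move=> fA fB ltAB; pose U := <<[seq coord_form j | j <- enum A]>>%VS.
have [/subsetP BU|/subsetPn[x xB xU]] :=
    boolP (B \subset [pred j | coord_form j \in U]).
  suff : (#|B| <= #|A|)%N by rewrite leqNgt ltAB.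
  have sBU : (<<[seq coord_form j | j <- enum B]>> <= U)%VS.
    apply/span_subvP => _ /mapP[j jB ->]; apply: BU.
    by rewrite -mem_enum.
  move: (dimvS sBU); rewrite /U.
  move: fA fB; rewrite /lin_indep /free => /eqP -> /eqP ->.
  by rewrite !size_map -!cardE.
have xA : x \notin A.
  apply: contra xU => xA; rewrite inE; apply: memv_span.
  by apply: map_f; rewrite mem_enum.
exists x; first by rewrite !inE xA.
rewrite /lin_indep.
have /perm_free -> : perm_eq [seq coord_form j | j <- enum (x |: A)]
    (coord_form x :: [seq coord_form j | j <- enum A]).
  rewrite -map_cons perm_map //; apply: uniq_perm.
  - exact: enum_uniq.
  - by rewrite /= mem_enum xA enum_uniq.
  by move=> y; rewrite inE !mem_enum !inE.
by rewrite free_cons; apply/andP.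
Qed.

Definition lin_matroid : matroid 'I_n :=
  Matroid lin_ground lin_set0 lin_sub lin_exchange.

End LinearMatroid.

(* Imported only now, as classical_sets shadows set0, setD, etc. of finset. *)
From mathcomp Require Import classical_sets reals complex.
From mathcomp.multinomials Require Import mpoly.

Local Open Scope classical_set_scope.

Section Inversion.
Variables (K : fieldType) (n : nat).
Implicit Types (X : set 'rV[K]_n) (I S T : {set 'I_n}) (x : 'rV[K]_n).

Definition supp x : {set 'I_n} := [set i | x 0 i != 0]%SET.

Definition coord_subspace S : set 'rV[K]_n := [set x | supp x \subset S].

Definition zariski_closure X : set 'rV[K]_n :=
  [set x | forall f : {mpoly K[n]},
     (forall y, X y -> f.@[y 0] = 0) -> f.@[x 0] = 0].

Definition coord_inv_point I x : 'rV[K]_n :=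
  \row_i (if i \in I then (x 0 i)^-1 else x 0 i).

(* inv_I is a rational map, defined only where the coordinates in I are all
   nonzero; the convention 0^-1 = 0 is never used.  If X misses that locus, the
   image is empty, and so is its closure. *)
Definition coord_inv I X : set 'rV[K]_n :=
  zariski_closure (coord_inv_point I @` (X `&` [set x | I \subset supp x])).

(* K^T is 'rV[K]_#|T|, the coordinate labelled by i \in T being at the position
   of i in the increasing enumeration of T. *)
Definition coord_proj T x : 'rV[K]_#|T| := \row_j x 0 (enum_val j).

Definition zero_pad T (y : 'rV[K]_#|T|) : 'rV[K]_n :=
  \row_i \sum_(j | enum_val j == i) y 0 j.

Fact zero_padK T : cancel (@zero_pad T) (coord_proj T).
Proof.
move=> y; apply/rowP => j; rewrite !mxE (bigD1 j) //= big1 ?addr0 // => k.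
by case/andP=> /eqP/enum_val_inj ->; rewrite eqxx.
Qed.

Fact supp_zero_pad T (y : 'rV[K]_#|T|) : supp (zero_pad y) \subset T.
Proof.
apply/fintype.subsetP => i; rewrite inE mxE; apply: contraR => iT.
rewrite big1 // => j /eqP ij; case/negP: iT; rewrite -ij; exact: enum_valP.
Qed.

End Inversion.

Arguments coord_proj {K n} T x.
Arguments zero_pad {K n T} y.

(* A \cap T, relabelled as a set of coordinates of K^T *)
Definition relabel n (T A : {set 'I_n}) : {set 'I_#|T|} :=
  [set j | enum_val j \in A]%SET.

(* Main.v *)
(* Everything follows from a pointwise description of inv_I(L): with
   T = supp p \cup ([n] \ I), a point p lies in inv_I(L) iff some u in L agrees
   with inv_I(p) on T, and some v in L vanishes exactly on T.  Given u and v, p is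
   the limit of inv_I(u + v / t) as t tends to 0, and a polynomial in these points
   is a rational function of t regular at 0.  Conversely, a linear relation that
   obstructs u or v becomes, after inverting the coordinates in I and clearing
   denominators, a polynomial that vanishes on inv_I(L) but not at p.  Finally, F
   is a flat iff some vector of L vanishes exactly on F. *)
Require Import Defs.
From HB Require Import structures.
From mathcomp Require Import all_boot all_order all_algebra.
From mathcomp Require Import classical_sets reals complex.
From mathcomp.multinomials Require Import mpoly.

Set Implicit Arguments.
Unset Strict Implicit.
Unset Printing Implicit Defensive.

Import Order.TTheory GRing.Theory Num.Theory.

Local Open Scope ring_scope.
Local Open Scope complex_scope.
Local Open Scope classical_set_scope.

(** * Linear forms that separate a vector from a subspace *)

Section Separation.
Variables (K : fieldType) (n : nat).
Implicit Types (V L : {vspace 'rV[K]_n}) (w : 'rV[K]_n) (A F : {set 'I_n}).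

(** The map [g], identity minus a projection onto [V], kills [V] but not [w]. A coordinate of [g]
    that is nonzero at [w] is the required form; its coefficients are the entries of [g] in the
    standard basis. *)
Lemma separating_form V w : w \notin V ->
  exists2 a : 'I_n -> K, (forall y, y \in V -> \sum_i a i * y 0 i = 0)
    & \sum_i a i * w 0 i != 0.
Proof.
move=> wV.
pose g : 'End('rV[K]_n) := (\1 - projv V)%VF.
have gE k (y : 'rV[K]_n) : \sum_i (g (delta_mx 0 i) 0 k) * y 0 i = g y 0 k.
  rewrite [in RHS](row_sum_delta y) linear_sum summxE; apply: eq_bigr => i _.
  by rewrite linearZ mxE mulrC.
have gV y : y \in V -> g y = 0.
  by move=> yV; rewrite !lfun_simp projv_id ?subrr.
have [k gwk] : exists k, g w 0 k != 0.
  apply/existsP; apply: contraR wV => /existsPn gw0.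
  have : g w = 0 by apply/rowP => k; rewrite [RHS]mxE; apply/eqP/negPn/gw0.
  by rewrite !lfun_simp => /subr0_eq /= ->; apply: memv_proj.
by exists (fun i => g (delta_mx 0 i) 0 k) => [y yV|]; rewrite gE // gV ?mxE.
Qed.

Definition mask A w : 'rV[K]_n := \row_i (if i \in A then w 0 i else 0).

Fact mask_is_linear A : linear (mask A).
Proof.
by move=> c u v; apply/rowP => i; rewrite !mxE; case: ifP; rewrite ?mulr0 ?addr0.
Qed.
HB.instance Definition _ A :=
  GRing.isLinear.Build _ _ _ _ (mask A) (mask_is_linear A).

(** Separation applied to the image of [L] under [mask A]: either [mask A w] lies in that image, or
    a form vanishing on the image detects it. *)
Lemma extension_or_relation L A w :
  (exists2 u, u \in L & {in A, forall i, u 0 i = w 0 i})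
  \/ (exists2 a : 'I_n -> K,
        forall y, y \in L -> \sum_(i in A) a i * y 0 i = 0
        & \sum_(i in A) a i * w 0 i != 0).
Proof.
have maskE (a : 'I_n -> K) (y : 'rV[K]_n) :
    \sum_i a i * mask A y 0 i = \sum_(i in A) a i * y 0 i.
  rewrite [RHS]big_mkcond; apply: eq_bigr => i _; rewrite mxE.
  by case: ifP => //; rewrite mulr0.
have [/memv_imgP[u uL]|/separating_form[a aL aw]] :=
    boolP (mask A w \in linfun (mask A) @: L)%VS.
  rewrite lfunE => /rowP wu; left; exists u => // i iA.
  by have := wu i; rewrite !mxE iA.
right; exists a; last by rewrite -maskE.
move=> y yL; rewrite -maskE; apply: aL.
by rewrite -(lfunE (mask A)) memv_img.
Qed.

(** The previous alternative for the unit vector at [x]: a relation that fails there is one with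
    [a x] nonzero. *)
Lemma vanishing_or_dependent L F (x : 'I_n) : x \notin F ->
  (exists v, [/\ v \in L, {in F, forall i, v 0 i = 0} & v 0 x != 0])
  \/ (exists2 a : 'I_n -> K, a x != 0 &
        forall y, y \in L -> \sum_(i in x |: F) a i * y 0 i = 0).
Proof.
move=> xF.
have [[v vL vE]|[a aL ax]] := extension_or_relation L (x |: F)%SET (delta_mx 0 x).
  left; exists v; split=> // [i iF|].
    rewrite vE ?setU1r // mxE eqxx /=; case: eqP => // ix.
    by rewrite -ix iF in xF.
  by rewrite vE ?setU11 // mxE !eqxx oner_neq0.
right; exists a => //; move: ax; rewrite (bigD1 x) ?setU11 //= big1.
  by rewrite mxE !eqxx mulr1 addr0.
by move=> i /andP[_ /negPf ix]; rewrite mxE eqxx ix mulr0.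
Qed.

End Separation.

(** * Generic choices over an infinite field *)

Section Avoidance.
Variables (K : numFieldType).

(** In characteristic 0 the naturals below [size p] are distinct in [K], and they are too many to be
    all roots. *)
Lemma exists_nonroot (p : {poly K}) : p != 0 -> exists t, p.[t] != 0.
Proof.
move=> p0; pose s : seq K := [seq i%:R | i <- iota 0 (size p)].
have us : uniq s.
  by rewrite map_inj_uniq ?iota_uniq // => i j /eqP; rewrite eqr_nat => /eqP.
have : ~~ all (root p) s.
  apply/negP => rs; have := max_poly_roots p0 rs us.
  by rewrite size_map size_iota ltnn.
by case/allPn => t _ pt; exists t.
Qed.

Variables (n : nat) (L : {vspace 'rV[K]_n}).
Implicit Types F G : {set 'I_n}.

(** Each relevant coordinate is a nonzero polynomial [q i] of degree at most 1 in [t], so any [t]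
    off the roots of their product works. *)
Lemma generic_combination (v w : 'rV[K]_n) : exists t, forall i,
  (v 0 i != 0) || (w 0 i != 0) -> (t *: w + v) 0 i != 0.
Proof.
pose q i := w 0 i *: 'X + (v 0 i)%:P.
pose P i := (v 0 i != 0) || (w 0 i != 0).
have [|t] := @exists_nonroot (\prod_(i | P i) q i).
  apply/prodf_neq0 => i Pi; apply/eqP => q0.
  have := congr1 (fun p : {poly K} => p`_0) q0.
  have := congr1 (fun p : {poly K} => p`_1) q0.
  rewrite /q !coefE /= !mulr0 mulr1 add0r addr0 => w0 v0.
  by move: Pi; rewrite /P w0 v0 eqxx.
rewrite horner_prod => /prodf_neq0 qt; exists t => i Pi.
by have := qt i Pi; rewrite /q !hornerE !mxE mulrC.
Qed.

(** Vectors that are each nonzero at one point of [G] merge into one, by induction along a list of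
    [G]: a generic combination keeps the nonzero coordinates of both summands. *)
Lemma generic_vector F G :
  (forall x, x \in G ->
     exists v, [/\ v \in L, {in F, forall i, v 0 i = 0} & v 0 x != 0]) ->
  exists v, [/\ v \in L, {in F, forall i, v 0 i = 0}
                & {in G, forall x, v 0 x != 0}].
Proof.
move=> FG.
have {FG}: {in enum G, forall x, exists v,
    [/\ v \in L, {in F, forall i, v 0 i = 0} & v 0 x != 0]}.
  by move=> x; rewrite mem_enum; apply: FG.
suff gen (s : seq 'I_n) : {in s, forall x, exists v,
    [/\ v \in L, {in F, forall i, v 0 i = 0} & v 0 x != 0]} ->
  exists v, [/\ v \in L, {in F, forall i, v 0 i = 0}
                & {in s, forall x, v 0 x != 0}].
  move=> /gen[v [vL vF vG]]; exists v; split=> // x xG.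
  by apply: vG; rewrite mem_enum.
elim: s => [_|x s IH xs].
  by exists 0; split=> // [|i _]; rewrite ?mem0v ?mxE.
have [|v [vL vF vs]] := IH; first by move=> y ys; apply: xs; rewrite inE ys orbT.
have [|w [wL wF wx]] := xs x; first by rewrite inE eqxx.
have [t tE] := generic_combination v w.
exists (t *: w + v); split=> [|i iF|y].
- by rewrite memvD ?memvZ.
- by rewrite !mxE vF ?wF // mulr0 addr0.
by rewrite inE => /predU1P[->|ys]; apply: tE; rewrite ?wx ?orbT ?vs.
Qed.

End Avoidance.

(** * Rational functions of one variable regular at 0 *)

Section RegularFunctions.
Variable K : numFieldType.
Implicit Types g h : K -> K.

(* The value of g at the zeros of B is arbitrary. *)
Definition regular_at0 g := exists A B : {poly K},
  B.[0] != 0 /\ forall t, B.[t] != 0 -> g t = A.[t] / B.[t].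

Lemma regular_poly (A : {poly K}) : regular_at0 (horner A).
Proof. by exists A, 1; split=> [|t _]; rewrite ?hornerE ?oner_neq0 ?divr1. Qed.

Lemma regular_inv (B : {poly K}) : B.[0] != 0 -> regular_at0 (fun t => B.[t]^-1).
Proof. by move=> B0; exists 1, B; split=> // t _; rewrite hornerE div1r. Qed.

Lemma regularD g h : regular_at0 g -> regular_at0 h ->
  regular_at0 (fun t => g t + h t).
Proof.
move=> [A [B [B0 gE]]] [A' [B' [B0' hE]]].
exists (A * B' + A' * B), (B * B'); split=> [|t]; first by rewrite hornerE mulf_neq0.
by rewrite !hornerE mulf_eq0 negb_or => /andP[Bt Bt']; rewrite gE // hE // addf_div.
Qed.

Lemma regularM g h : regular_at0 g -> regular_at0 h ->
  regular_at0 (fun t => g t * h t).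
Proof.
move=> [A [B [B0 gE]]] [A' [B' [B0' hE]]].
exists (A * A'), (B * B'); split=> [|t]; first by rewrite hornerE mulf_neq0.
by rewrite !hornerE mulf_eq0 negb_or => /andP[Bt Bt']; rewrite gE // hE // mulf_div.
Qed.

Lemma eq_regular g h : g =1 h -> regular_at0 g -> regular_at0 h.
Proof.
by move=> gh [A [B [B0 gE]]]; exists A, B; split=> // t; rewrite -gh; apply: gE.
Qed.

Lemma regular_cst (c : K) : regular_at0 (fun=> c).
Proof. by apply: eq_regular (regular_poly c%:P) => t; rewrite hornerC. Qed.

Lemma regularX g m : regular_at0 g -> regular_at0 (fun t => g t ^+ m).
Proof.
move=> rg; elim: m => [|m IH]; first exact: regular_cst.
by apply: eq_regular (regularM rg IH) => t; rewrite exprS.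
Qed.

Lemma regular_prod (J : Type) (s : seq J) (g : J -> K -> K) :
  (forall j, regular_at0 (g j)) -> regular_at0 (fun t => \prod_(j <- s) g j t).
Proof.
move=> rg; elim: s => [|j s IH].
  by apply: eq_regular (regular_cst 1) => t; rewrite big_nil.
by apply: eq_regular (regularM (rg j) IH) => t; rewrite big_cons.
Qed.

Lemma regular_meval n (f : {mpoly K[n]}) (y : K -> 'I_n -> K) :
  (forall i, regular_at0 (y^~ i)) -> regular_at0 (fun t => f.@[y t]).
Proof.
move=> ry; elim/mpolyind: f => [|c m f _ _ IH].
  by apply: eq_regular (regular_cst 0) => t; rewrite meval0.
have rm : regular_at0 (fun t => c * \prod_i y t i ^+ m i).
  apply: regularM; first exact: regular_cst.
  by apply: regular_prod => i; apply: regularX.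
by apply: eq_regular (regularD rm IH) => t; rewrite mevalD mevalZ mevalX.
Qed.

(** An algebraic substitute for continuity at 0. With [g = A / B], if [g 0] were nonzero then
    [A * B * D] would be a nonzero polynomial, and at a nonroot of it [g] is both zero and
    nonzero. *)
Lemma regular_at0_eq0 g (D : {poly K}) : regular_at0 g -> D != 0 ->
  (forall t, D.[t] != 0 -> g t = 0) -> g 0 = 0.
Proof.
move=> [A [B [B0 gE]]] D0 gD; apply/eqP; rewrite gE //.
rewrite mulf_eq0; apply/orP; left; apply/negPn/negP => A0.
have nz (C : {poly K}) : C.[0] != 0 -> C != 0.
  by apply: contraNneq => ->; rewrite horner0.
have /exists_nonroot[t] : A * B * D != 0 by rewrite !mulf_neq0 // nz.
rewrite !hornerE !mulf_eq0 !negb_or => /andP[/andP[At Bt] Dt].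
move/eqP: (gD t Dt); rewrite gE // mulf_eq0 invr_eq0.
by rewrite (negPf At) (negPf Bt).
Qed.

End RegularFunctions.

(** * Pointwise description of the inverted subspace *)

Section InversionPoints.
Variables (K : numFieldType) (n : nat) (L : {vspace 'rV[K]_n}).
Implicit Types (I J : {set 'I_n}) (p x : 'rV[K]_n).

Lemma sum_setUC I J (F : 'I_n -> K) : J \subset I ->
  \sum_(i in J :|: ~: I) F i = \sum_(i in J) F i + \sum_(i in ~: I) F i.
Proof.
move=> JI; rewrite -bigU /=; first by apply: eq_bigl => i; rewrite inE.
by rewrite finset.disjoints_subset finset.setCK.
Qed.

(* The given relation after x_j is replaced by 1/x_j for j in J and the
   denominators are cleared. *)
Lemma inverted_relation I J p (a : 'I_n -> K) : J \subset I ->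
  coord_inv I [set` L] p ->
  (forall y, y \in L -> \sum_(i in J :|: ~: I) a i * y 0 i = 0) ->
  \prod_(j in J) p 0 j * \sum_(i in ~: I) a i * p 0 i +
    \sum_(i in J) a i * \prod_(j in J :\ i) p 0 j = 0.
Proof.
move=> JI pL aL.
pose f : {mpoly K[n]} := \prod_(j in J) 'X_j * \sum_(i in ~: I) a i *: 'X_i +
    \sum_(i in J) a i *: \prod_(j in J :\ i) 'X_j.
have fE (y : 'rV[K]_n) : f.@[y 0] =
    \prod_(j in J) y 0 j * \sum_(i in ~: I) a i * y 0 i +
    \sum_(i in J) a i * \prod_(j in J :\ i) y 0 j.
  rewrite mevalD mevalM rmorph_prod !raddf_sum; congr (_ * _ + _).
  - by apply: eq_bigr => j _; apply: mevalXU.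
  - by apply: eq_bigr => j _; rewrite /= mevalZ mevalXU.
  apply: eq_bigr => i _; rewrite /= mevalZ rmorph_prod; congr (_ * _).
  by apply: eq_bigr => j _; apply: mevalXU.
(* Since [p] is in the Zariski closure, it is enough that [f] vanishes at the inverse of each [x] in
   [L] with nonzero coordinates on [I]. *)
rewrite -fE; apply: pL => _ [x [/= xL /fintype.subsetP xI] <-]; rewrite fE.
have := aL x xL; rewrite sum_setUC // => ax.
have -> : \sum_(i in ~: I) a i * coord_inv_point I x 0 i =
    \sum_(i in ~: I) a i * x 0 i.
  by apply: eq_bigr => i; rewrite inE mxE => /negPf ->.
(* There [f] is the original relation times the product of the [1/x_j]; in the term of [i] in [J],
   the factor [1/x_i] cancels [x_i]. *)
transitivity (\prod_(j in J) coord_inv_point I x 0 j *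
  (\sum_(i in J) a i * x 0 i + \sum_(i in ~: I) a i * x 0 i)); last first.
  by rewrite ax mulr0.
rewrite mulrDr addrC; congr (_ + _); rewrite mulr_sumr.
apply: eq_bigr => i iJ; have iI := fintype.subsetP JI i iJ.
rewrite (big_setD1 i iJ) /= mxE iI [RHS]mulrC -mulrA.
by rewrite mulVKf //; have := xI i iI; rewrite inE.
Qed.

(** On [T] the inverse of [p] involves no division by zero, because an index in both [T] and [I]
    lies in [supp p]. *)
Lemma coord_invP I p : let T := (supp p :|: ~: I)%SET in
  coord_inv I [set` L] p <->
  (exists2 u, u \in L & {in T, forall i, u 0 i = coord_inv_point I p 0 i})
  /\ (exists2 v, v \in L & forall i, (v 0 i == 0) = (i \in T)).
Proof.
move=> T; have TE i : (i \in T) = (p 0 i != 0) || (i \notin I) by rewrite !inE.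
split=> [pL|[[u uL uE] [v vL vE]]].
  split.
    have [//|[a aL]] := extension_or_relation L T (coord_inv_point I p).
    set J := (supp p :&: I)%SET.
    have JI : J \subset I by apply: finset.subsetIr.
    have TJ : T = (J :|: ~: I)%SET.
      by apply/setP => i; rewrite !inE; case: (i \in I); rewrite ?andbT ?orbT ?orbF.
    have pJ j : j \in J -> p 0 j != 0 by rewrite !inE => /andP[].
    case/negP; rewrite TJ sum_setUC //.
    have := inverted_relation JI pL (a := a).
    rewrite -TJ => /(_ aL) rel.
    have PJ : \prod_(j in J) p 0 j != 0 by apply/prodf_neq0.
    (* Multiplication by the nonzero product of the [p_j], [j] in [J], turns the relation at the
       inverse of [p] into [rel]. *)
    rewrite -(mulrI_eq0 _ (mulfI PJ)) mulrDr -[X in _ == X]rel addrC.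
    apply/eqP; congr (_ * _ + _).
      by apply: eq_bigr => i; rewrite !inE mxE => /negPf ->.
    rewrite mulr_sumr; apply: eq_bigr => i iJ.
    rewrite (big_setD1 i iJ) /= mxE (fintype.subsetP JI i iJ) [LHS]mulrC -[LHS]mulrA.
    by rewrite mulKf // pJ.
  have [x|v [vL vT vnT]] := @generic_vector K n L T (~: T).
    rewrite inE => xT; have [//|[a ax aL]] := vanishing_or_dependent L xT.
    move: (xT); rewrite TE negb_or !negbK => /andP[/eqP px xI].
    set J := (x |: (supp p :&: I))%SET.
    have JI : J \subset I by rewrite finset.subUset finset.sub1set xI finset.subsetIr.
    have TJ : (x |: T)%SET = (J :|: ~: I)%SET.
      apply/setP => i; rewrite !inE; case: eqP => //= _.
      by case: (i \in I); rewrite ?andbT ?orbT ?orbF.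
    have xJ : x \in J by rewrite finset.setU11.
    have := inverted_relation JI pL (a := a).
    rewrite -TJ => /(_ aL) /eqP.
    (* As [p_x = 0], every product containing the index [x] vanishes. What remains is [a x] times
       the product of [p_j] over [supp p :&: I], which cannot be zero. *)
    rewrite (big_setD1 x xJ) /= px !mul0r add0r (big_setD1 x xJ) /=.
    rewrite [X in _ + X]big1 ?addr0 => [|i /setD1P[ix iJ]]; last first.
      by rewrite (big_setD1 x) /= ?px ?mul0r ?mulr0 // in_setD1 eq_sym ix.
    rewrite mulf_eq0 (negPf ax) /= => /prodf_eq0[j].
    by rewrite !inE => /andP[/negPf -> /= /andP[/negPf ->]].
  exists v => // i; case: (boolP (i \in T)) => iT; first by rewrite vT ?eqxx.
  by apply/negbTE/vnT; rewrite inE.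
(* As t tends to 0, the inverse of u + v / t tends to p: it is p_i at i in T,
   and t / (t u_i + v_i) at the other coordinates. *)
move=> f fL.
pose q i := u 0 i *: 'X + (v 0 i)%:P : {poly K}.
pose y t i : K := if i \in T then p 0 i else t / (q i).[t].
have qE i t : (q i).[t] = u 0 i * t + v 0 i by rewrite /q !hornerE.
have ry i : regular_at0 (y^~ i).
  rewrite /y; case: (boolP (i \in T)) => iT; first exact: regular_cst.
  apply: regularM; first by apply: eq_regular (regular_poly 'X) => t; rewrite hornerX.
  by apply: regular_inv; rewrite qE mulr0 add0r vE.
have /meval_eq <- : y 0 =1 p 0.
  move=> i; rewrite /y; case: (boolP (i \in T)) => //.
  by rewrite TE negb_or !negbK => /andP[/eqP -> _]; rewrite mul0r.
(* Where this [D] is nonzero, [u + v / t] is defined and has nonzero coordinates off [T], so that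
   [y t] is an honest inverse of a point of [L]. *)
apply: (regular_at0_eq0 (D := 'X * \prod_(i in ~: T) q i) (regular_meval f ry)).
  rewrite mulf_neq0 ?polyX_eq0 //; apply/prodf_neq0 => i; rewrite inE => iT.
  apply: contraNneq iT => q0; rewrite -vE.
  by have := qE i 0; rewrite q0 horner0 mulr0 add0r => <-.
move=> t; rewrite hornerM hornerX horner_prod mulf_eq0 negb_or => /andP[t0 /prodf_neq0 qt].
pose x : 'rV[K]_n := u + t^-1 *: v.
have xE i : i \notin T -> x 0 i = (q i).[t] / t.
  by rewrite !mxE qE mulrDl mulfK // [t^-1 * _]mulrC.
have xT i : i \in T -> x 0 i = u 0 i.
  by rewrite -vE !mxE => /eqP ->; rewrite mulr0 addr0.
rewrite -(fL (coord_inv_point I x)).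
  apply: meval_eq => i; rewrite /y mxE; case: (boolP (i \in T)) => iT.
    by rewrite xT // uE // mxE; case: (i \in I); rewrite ?invrK.
  move: (iT); rewrite TE negb_or !negbK => /andP[_ ->].
  by rewrite xE // invf_div.
exists x => //; split=> /=; first by rewrite memvD ?memvZ.
apply/fintype.subsetP => i iI; rewrite inE; case: (boolP (i \in T)) => iT.
  rewrite xT // uE // mxE iI invr_eq0.
  by move: iT; rewrite TE iI orbF.
by rewrite xE // mulf_neq0 ?invr_eq0 // qt // inE.
Qed.

End InversionPoints.

(** * Flats of the linear matroid as zero sets of vectors *)

Section LinearFlats.
Variables (K : numFieldType) (n : nat) (L : {vspace 'rV[K]_n}).
Implicit Types (A B F T : {set 'I_n}) (x : 'I_n).

Let forms A := [seq coord_form L j | j <- enum A].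

(** A relation with [a x] nonzero can be solved for the form of [x]; conversely, a form in the span
    vanishes wherever all the forms of [F] do. *)
Lemma notin_span_formsP F x : x \notin F ->
  reflect (exists v, [/\ v \in L, {in F, forall i, v 0 i = 0} & v 0 x != 0])
          (coord_form L x \notin <<forms F>>%VS).
Proof.
move=> xF; apply: (iffP idP) => [xspan|[v [vL vF vx]]].
  have [//|[a ax aL]] := vanishing_or_dependent L xF; case/negP: xspan.
  have -> : coord_form L x = \sum_(i in F) (- (a i / a x)) *: coord_form L i.
    apply/lfunP => w; rewrite sum_lfunE coord_formE.
    have := aL _ (subvsP w); rewrite big_setU1 //= => /eqP.
    rewrite addr_eq0 => /eqP/(canRL (mulKf ax)) ->.
    rewrite mulrN mulr_sumr -sumrN; apply: eq_bigr => i _.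
    rewrite scale_lfunE coord_formE -[RHS]/(- (a i / a x) * _).
    by rewrite mulNr [a i / _]mulrC mulrA.
  apply: memv_suml => i iF; apply/memvZ/memv_span/map_f.
  by rewrite mem_enum.
pose w := Subvs vL.
apply: contraNN vx => /coord_span xE.
rewrite -[v]/(vsval w) -coord_formE xE sum_lfunE big1 // => k _.
have kF : (k < size (enum F))%N by rewrite -cardE ltn_ord.
rewrite scale_lfunE (nth_map x) // coord_formE /= vF ?scaler0 //.
by rewrite -mem_enum mem_nth.
Qed.

(** An independent subset of [A] of largest size spans all the forms of [A], since a form outside
    its span could be added to it. *)
Lemma mrank_dim A : mrank (lin_matroid L) A = \dim <<forms A>>.
Proof.
have dimB B : indep (lin_matroid L) B -> \dim <<forms B>> = #|B|.
  by rewrite /= /lin_indep /free => /eqP ->; rewrite size_map -cardE.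
have sub (B C : {set 'I_n}) : B \subset C -> (<<forms B>> <= <<forms C>>)%VS.
  move=> /fintype.subsetP BC; apply: sub_span => _ /mapP[j jB ->].
  by apply: map_f; move: jB; rewrite !mem_enum; apply: BC.
apply/eqP; rewrite eqn_leq; apply/andP; split.
  by apply/bigmax_leqP => B /andP[BA iB]; rewrite -dimB // dimvS // sub.
pose P (B : {set 'I_n}) := (B \subset A) && indep (lin_matroid L) B.
have P0 : P finset.set0 by rewrite /P finset.sub0set indep_set0.
have [B /andP[BA iB] Bmax] := arg_maxnP (fun B : {set 'I_n} => #|B|) P0.
suff AB : (<<forms A>> <= <<forms B>>)%VS.
  apply: leq_trans (dimvS AB) _; rewrite dimB //.
  by apply: leq_bigmax_cond; rewrite BA.
apply/span_subvP => _ /mapP[x xA ->]; apply/negPn/negP => xB.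
have xnB : x \notin B.
  apply: contra xB => xB; apply/memv_span/map_f; by rewrite mem_enum.
have /Bmax : P (x |: B)%SET.
  rewrite /P finset.subUset finset.sub1set -mem_enum xA BA /= /lin_indep.
  have /perm_free -> : perm_eq (forms (x |: B)) (coord_form L x :: forms B).
    rewrite -map_cons perm_map //; apply: uniq_perm.
    - exact: enum_uniq.
    - by rewrite /= mem_enum xnB enum_uniq.
    by move=> y; rewrite inE !mem_enum !inE.
  by rewrite free_cons xB.
by rewrite /= cardsU1 xnB add1n ltnn.
Qed.

Lemma mrank_restriction T A : A \subset T ->
  mrank (restriction (lin_matroid L) T) A = mrank (lin_matroid L) A.
Proof.
move=> AT; apply: eq_bigl => B /=; case: (boolP (B \subset A)) => //= BA.
by rewrite (fintype.subset_trans BA AT).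
Qed.

Lemma mrank_ltP F x : x \notin F ->
  reflect (exists v, [/\ v \in L, {in F, forall i, v 0 i = 0} & v 0 x != 0])
    (mrank (lin_matroid L) F < mrank (lin_matroid L) (x |: F))%N.
Proof.
move=> xF; rewrite !mrank_dim.
have -> : <<forms (x |: F)>>%VS = (<[coord_form L x]> + <<forms F>>)%VS.
  rewrite -span_cons; apply/eq_span => f; rewrite -map_cons.
  by apply: eq_mem_map => y; rewrite inE !mem_enum !inE.
have -> : (\dim <<forms F>> < \dim (<[coord_form L x]> + <<forms F>>))%N =
    (coord_form L x \notin <<forms F>>%VS).
  have sF := addvSr <[coord_form L x]> <<forms F>>.
  rewrite ltn_neqAle dimvS // andbT (dimv_leqif_eq sF) eq_sym memvE.
  by rewrite (sameP eqP addv_idPr).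
exact: notin_span_formsP.
Qed.

(** A rank jump at [x] amounts to a vector of [L] vanishing on [F] but not at [x]. Such vectors for
    all [x] in [T :\: F] merge into one by [generic_vector], and that one serves every [x]. *)
Lemma flat_restrictionP T F : F \subset T ->
  flat (restriction (lin_matroid L) T) F <->
  exists2 v, v \in L & {in T, forall i, (v 0 i == 0) = (i \in F)}.
Proof.
move=> FT; rewrite /flat /= finset.setTI FT /=; split.
  move=> /forall_inP TF.
  have [x|v [vL vF vT]] := @generic_vector K n L F (T :\: F).
    move=> xTF; move: (TF x xTF); case/setDP: xTF => xT xF.
    rewrite !mrank_restriction //; last first.
      by rewrite finset.subUset finset.sub1set xT.
    by move/mrank_ltP; apply.
  exists v => // i iT; case: (boolP (i \in F)) => iF; first by rewrite vF ?eqxx.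
  by apply/negbTE/vT; rewrite inE iF.
move=> [v vL vE]; apply/forall_inP => x /setDP[xT xF].
rewrite !mrank_restriction //; last by rewrite finset.subUset finset.sub1set xT.
apply/mrank_ltP => //; exists v; split=> // [i iF|]; last by rewrite vE.
by apply/eqP; rewrite vE // (fintype.subsetP FT).
Qed.

Lemma flat_linP F : flat (lin_matroid L) F <->
  exists2 v, v \in L & forall i, (v 0 i == 0) = (i \in F).
Proof.
have -> : flat (lin_matroid L) F = flat (restriction (lin_matroid L) finset.setT) F.
  rewrite /flat /= finset.setTI; congr andb; apply: eq_forallb => x.
  by rewrite !mrank_restriction ?finset.subsetT.
rewrite flat_restrictionP ?finset.subsetT //.
by split=> -[v vL vE]; exists v => // i; rewrite vE ?inE.
Qed.

End LinearFlats.

(** * Coordinate projections and sections of a subspace *)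

Section CoordinateProjection.
Variables (K : numFieldType) (n : nat) (L : {vspace 'rV[K]_n}).
Variable T : {set 'I_n}.

Fact coord_proj_is_linear : linear (@coord_proj K n T).
Proof. by move=> c u v; apply/rowP => j; rewrite !mxE. Qed.
HB.instance Definition _ :=
  GRing.isLinear.Build _ _ _ _ (@coord_proj K n T) coord_proj_is_linear.

Lemma in_enum_val i : i \in T -> exists j : 'I_#|T|, i = enum_val j.
Proof. by move=> iT; exists (enum_rank_in iT i); rewrite enum_rankK_in. Qed.

Lemma zero_pad_enum_val (y : 'rV[K]_#|T|) j : zero_pad y 0 (enum_val j) = y 0 j.
Proof. by have /rowP/(_ j) := zero_padK y; rewrite mxE. Qed.

Lemma zero_pad_out (y : 'rV[K]_#|T|) i : i \notin T -> zero_pad y 0 i = 0.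
Proof.
move=> iT; apply/eqP/(contraNT _ iT) => yi.
by apply: (fintype.subsetP (supp_zero_pad y)); rewrite inE.
Qed.

(** Presents the section as a [{vspace}], the form in which [coord_invP] can be applied to it. *)
Lemma proj_section_vspace (A : {set 'I_#|T|}) : exists N : {vspace 'rV[K]_#|T|},
  coord_proj T @` [set` L] `&` coord_subspace A = [set` N].
Proof.
exists (linfun (coord_proj T) @: L :&: lker (linfun (mask (~: A))))%VS.
have kerE (y : 'rV[K]_#|T|) :
    (y \in lker (linfun (mask (~: A)))) = (supp y \subset A).
  rewrite memv_ker lfunE; apply/eqP/fintype.subsetP => [/rowP y0 j|yA].
    rewrite inE; apply: contraR => jA; have := y0 j.
    by rewrite !mxE inE jA => ->.
  apply/rowP => j; rewrite !mxE inE; case: ifPn => // jA.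
  by apply/eqP/(contraNT _ jA) => yj; apply: yA; rewrite inE.
apply/seteqP; split=> y /=.
  move=> [[x xL <-] xA].
  by rewrite memv_cap kerE xA -(lfunE (coord_proj T)) memv_img.
rewrite memv_cap kerE => /andP[/memv_imgP[x xL ->] xA]; split=> //.
by exists x; rewrite ?lfunE.
Qed.

End CoordinateProjection.

(** * Intersections with coordinate subspaces and supports *)

Section InversionAndFlats.
Variables (K : numFieldType) (n : nat) (L : {vspace 'rV[K]_n}).
Variables I S : {set 'I_n}.
Let M := lin_matroid L.
Let T := (S :|: ~: I)%SET.

(** Both sides are unfolded by [coord_invP]. The witnesses [u], [v] for [p] project to witnesses in
    the coordinates of [T]; in the other direction, [v] must be corrected outside [T], by the vector
    [v0] that flatness provides. *)
Lemma coord_inv_subspace : flat M T ->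
  coord_inv I [set` L] `&` coord_subspace S =
  zero_pad @` coord_inv (relabel T (S :&: I))
    (coord_proj T @` [set` L] `&` coord_subspace (relabel T S)).
Proof.
move=> /flat_linP[v0 v0L v0E].
(* Within [T], the sets [I] and [S :&: I] agree, because [T :\: S] avoids [I]. *)
have inJ (j : 'I_#|T|) : (j \in relabel T (S :&: I)) = (enum_val j \in I).
  have := enum_valP j; rewrite !inE.
  by case: (enum_val j \in I); rewrite ?andbF ?andbT ?orbF.
have inS (j : 'I_#|T|) : enum_val j \in I -> enum_val j \in S.
  by have := enum_valP j; rewrite !inE => /orP[//|/negPf ->].
have [N NE] := proj_section_vspace L (relabel T S).
have inN y : y \in N <->
    (exists2 x, x \in L & coord_proj T x = y) /\ supp y \subset relabel T S.
  by rewrite -[is_true (y \in N)]/([set` N] y) -NE.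
rewrite NE; apply/seteqP; split=> p /=.
  move=> [/coord_invP[[u uL uE] [v vL vE]] pS]; exists (coord_proj T p); last first.
    apply/rowP => i; have [/in_enum_val[j ->]|iT] := boolP (i \in T).
      by rewrite zero_pad_enum_val mxE.
    rewrite zero_pad_out //; apply/esym/eqP/(contraNT _ iT) => pi.
    by rewrite inE (fintype.subsetP pS) // inE.
  apply/coord_invP; split.
    exists (coord_proj T u).
      apply/inN; split; first by exists u.
      apply/fintype.subsetP => j; rewrite !inE mxE; apply: contraR => jS.
      have jI : enum_val j \notin I by apply: contra jS; apply: inS.
      rewrite uE ?inE ?jI ?orbT // mxE (negPf jI).
      by apply: (contraNT _ jS) => pj; apply: (fintype.subsetP pS); rewrite inE.
    move=> j; rewrite finset.in_setU finset.in_setC inJ inE !mxE inJ => jT.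
    by rewrite uE ?mxE // finset.in_setU finset.in_setC inE.
  exists (coord_proj T v) => [|j]; last by rewrite finset.in_setU finset.in_setC inJ mxE vE !inE mxE.
  apply/inN; split; first by exists v.
  apply/fintype.subsetP => j; rewrite !inE mxE vE !inE negb_or !negbK.
  by case/andP=> _; apply: inS.
move=> [y /coord_invP[[u' /inN[[u uL <-] uS] uE] [v' /inN[[v vL <-] _] vE]] <-].
(* A coordinate of [T] outside [S] is not inverted, so there [y] equals the projection of [u], which
   is supported in [S]. *)
have yS : supp (zero_pad y) \subset S.
  apply/fintype.subsetP => i ip.
  have [j ij] := in_enum_val (fintype.subsetP (supp_zero_pad y) i ip).
  move: ip; rewrite {i}ij inE zero_pad_enum_val; apply: contraR => jS.
  have jI : enum_val j \notin I by apply: contra jS; apply: inS.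
  have := uE j; rewrite finset.in_setU finset.in_setC inJ jI orbT => /(_ isT).
  rewrite [in RHS]mxE inJ (negPf jI) => <-.
  by apply: contraR jS => uj; have := fintype.subsetP uS j; rewrite !inE => ->.
have yT : (supp (zero_pad y) :|: ~: I)%SET \subset T by apply: finset.setSU.
split=> //; apply/coord_invP; split.
  exists u => // i iT; have [j ij] := in_enum_val (fintype.subsetP yT i iT).
  have := uE j; rewrite finset.in_setU finset.in_setC inJ !mxE inJ inE => uj.
  move: iT; rewrite {i}ij finset.in_setU finset.in_setC inE zero_pad_enum_val.
  by move=> /uj ->; rewrite -!zero_pad_enum_val !mxE.
(* Adding a multiple of [v0] leaves [v] unchanged on [T] and, for generic [t], makes it nonzero
   everywhere else. *)
have [t tE] := generic_combination v v0.
exists (t *: v0 + v); first by rewrite memvD ?memvZ.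
move=> i; have [iT|iT] := boolP (i \in T); last first.
  rewrite (negPf (tE i _)) ?v0E ?iT ?orbT //.
  by apply/esym/negbTE; apply: contra iT; apply: (fintype.subsetP yT).
have /eqP v0i : v0 0 i == 0 by rewrite v0E.
have [j ij] := in_enum_val iT.
rewrite !mxE v0i mulr0 add0r ij; have := vE j.
by rewrite finset.in_setU finset.in_setC inJ mxE !inE zero_pad_enum_val.
Qed.

(** When [supp p = S], the set [T] of [coord_invP] is the present one. Then [v] witnesses that [T]
    is a flat, and [u], having within [T] the same zeros as [p], that [T :\: S] is a flat of the
    restriction. *)
Lemma coord_inv_suppP :
  (exists2 p, coord_inv I [set` L] p & supp p = S) <->
  flat M T /\ flat (restriction M T) (T :\: S).
Proof.
have ST : T :\: S \subset T by apply: finset.subsetDl.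
have inv0 x i : (coord_inv_point I x 0 i == 0) = (x 0 i == 0).
  by rewrite mxE; case: ifP; rewrite ?invr_eq0.
split=> [[p /coord_invP pL pS]|[/flat_linP vL /(flat_restrictionP _ ST) [u uL uE]]].
  move: pL; rewrite pS => -[[u uL uE] vL]; split; first exact/flat_linP.
  apply/(flat_restrictionP _ ST); exists u => // i iT.
  by rewrite uE // inv0 finset.in_setD iT andbT -pS inE negbK.
(* On [T] the point must be the inverse of [u]; off [T], hence off [S], it must vanish. *)
pose p : 'rV[K]_n := \row_i (if i \in T then coord_inv_point I u 0 i else 0).
have pS : supp p = S.
  apply/setP => i; rewrite inE mxE; case: ifPn => iT.
    by rewrite inv0 uE // finset.in_setD iT andbT negbK.
  by rewrite eqxx; apply/esym/negbTE; apply: contra iT; rewrite inE => ->.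
exists p => //; apply/coord_invP; rewrite pS; split=> //.
exists u => // i iT; rewrite !mxE iT.
by case: (i \in I); rewrite ?invrK.
Qed.

End InversionAndFlats.

Theorem theorem5p1 (R : realType) (n : nat) (L : {vspace 'rV[R[i]]_n})
    (I S : {set 'I_n})
    (noloop : forall i, i \in I -> ~~ loop (lin_matroid L) i) :
  let M := lin_matroid L in
  let T := (S :|: ~: I)%SET in
  (flat M T ->
     coord_inv I [set` L] `&` coord_subspace S =
     zero_pad @` coord_inv (relabel T (S :&: I))
              (coord_proj T @` [set` L] `&` coord_subspace (relabel T S)))
  /\
  ((exists2 p, coord_inv I [set` L] p & supp p = S) <->
   flat M T /\ flat (restriction M T) (T :\: S)).
Proof.
by move=> M T; split; [exact: coord_inv_subspace | exact: coord_inv_suppP].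
Qed.
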